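(* Let $P(x)=a_nx^n+\cdots+a_1x+a_0\in\mathbb{Z}[x]$ be a polynomial of degree $n\ge2$ and let $q\ge2$ be an integer satisfying $\gcd(a_n,\dots,a_0,q)=1$. Let $\mathcal{I}\subset\mathbb{R}$ be an interval of length at most $q^{1/n}$. Then the number $W$ of integers $x\in\mathcal{I}$ satisfying $P(x)\equiv0\pmod q$ satisfies $$W\le2(n-1)^2\,\omega(q).$$
   Context: $\omega(q)$ denotes the number of distinct prime divisors of $q$. *)

(* Defs.v *)
From HB Require Import structures.
From mathcomp Require Import all_boot all_order all_algebra.
From mathcomp Require Import all_classical all_reals all_analysis.
Set Implicit Arguments.
Unset Strict Implicit.
Unset Printing Implicit Defensive.
Import Order.TTheory GRing.Theory Num.Theory.
Import numFieldNormedType.Exports.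

Local Open Scope classical_set_scope.
Local Open Scope ring_scope.

Definition omega (q : nat) : nat := size (primes q).

Definition coef_gcd (P : {poly int}) : nat :=
  \big[gcdn/0%N]_(i < size P) absz (P`_i).

Definition roots_mod_in (R : realType) (P : {poly int}) (q : nat)
    (I : interval R) : set int :=
  [set x : int | (x%:~R : R) \in I /\ (P.[x] = 0 %[mod q%:Z])%Z].

(* Main.v *)
Require Import Defs.
From HB Require Import structures.
From mathcomp Require Import all_boot all_order all_algebra.
From mathcomp Require Import finmap.
From mathcomp Require Import all_classical all_reals all_analysis.
From mathcomp Require Import ring lra zify.
Set Implicit Arguments.
Unset Strict Implicit.
Unset Printing Implicit Defensive.
Import Order.TTheory GRing.Theory Num.Theory.
Import numFieldNormedType.Exports.
Local Open Scope classical_set_scope.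
Local Open Scope ring_scope.

(** The roots of [P] modulo [q] that lie in the interval become vectors of a
Euclidean space of small dimension, any two of which make an obtuse angle; such
a system has at most one vector more than the dimension.

Let [p ^ e] be the exact power of a prime [p] dividing [q], and write [v] for
the [p]-adic valuation.  Lagrange interpolation, with the fact that [p] does
not divide all coefficients of [P], shows that among [n + 1] roots one has
total valuation at least [e] against the others ([interpolation_dvd]).
Choosing [n] roots [Y] that minimise the sum of the mutual valuations, as for
Fekete points, gives a set such that every root [x] satisfies
[\sum_(y in Y) v (x - y) >= e]; so [Y] behaves like the multiset of [p]-adic
roots of [P], while consisting of integers ([fekete_cover]).

Congruence modulo the powers of [p] is a chain of equivalence relations, and
[v (x - y)] counts the relations of the chain that hold between [x] and [y].
Weighting these relations by suitable numbers of [[0, 1]] that depend only on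
the classes, one gets a positive semidefinite kernel [G <= v] whose sums over
[Y] are all equal to [e].  Then [K = G - e / n] is again positive semidefinite,
because subtracting from a test vector a multiple of the indicator of [Y]
removes its total mass, and [K] has rank at most [n - 1]
([refinement_kernel], [root_kernel]).

The sum of the kernels [K] over the primes [p] dividing [q], with weights
[ln p], is positive semidefinite of rank at most [(n - 1) * omega q].  Off the
diagonal it is at most [ln |x - y| - ln q / n], which is negative when
[|x - y| ^ n < q].  Hence there are at most [(n - 1) * omega q + 1] roots at
mutual distance less than [q ^ (1 / n)] ([close_roots_card]).

In an interval of length [q ^ (1 / n)] the distance may reach the bound, but
only between the two extreme roots; removing the largest root costs one more
unit ([clustered_roots_card]).  The total [(n - 1) * omega q + 2] is at most
[2 * (n - 1) ^ 2 * omega q] except when [n = 2] and [omega q = 1]; when [q] is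
a prime power, [interpolation_dvd] gives directly the bound [n]
([prime_power_roots_card]). *)

(** * Products of prime powers *)

Lemma sum_dvd_exp (p e d : nat) : prime p -> (0 < d)%N ->
  (\sum_(k < e) (p ^ k.+1 %| d) = minn e (logn p d))%N.
Proof.
move=> p_pr d_gt0; elim: e => [|e IH]; first by rewrite big_ord0 min0n.
by rewrite big_ord_recr /= IH pfactor_dvdn //; lia.
Qed.

(** Truncation at [e] only matters for a term that exceeds [e], and such a term
is enough by itself after truncation. *)
Lemma leq_sum_minn (I : finType) (P : pred I) (f : I -> nat) (e : nat) :
  (e <= \sum_(i | P i) f i)%N -> (e <= \sum_(i | P i) minn e (f i))%N.
Proof.
have [/existsP[i /andP[Pi ei]] _|noi] := boolP [exists i, P i && (e <= f i)%N].
  by rewrite (bigD1 i) //= (minn_idPl ei) leq_addr.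
rewrite [X in _ -> (_ <= X)%N](eq_bigr f) // => i Pi.
move: noi; rewrite negb_exists => /forallP/(_ i).
by rewrite Pi /= -ltnNge => /ltnW/minn_idPr.
Qed.

Lemma logn_prod (I : finType) (P : pred I) (f : I -> nat) (p : nat) :
  (forall i, P i -> (0 < f i)%N) ->
  logn p (\prod_(i | P i) f i) = (\sum_(i | P i) logn p (f i))%N.
Proof.
move=> f_gt0.
have [] // : (logn p (\prod_(i | P i) f i) = \sum_(i | P i) logn p (f i))%N /\
   (0 < \prod_(i | P i) f i)%N.
elim/big_rec2: _ => [|i s t Pi [<- t_gt0]]; first by rewrite logn1.
by rewrite lognM ?f_gt0 // muln_gt0 f_gt0.
Qed.

Lemma prod_pfactor_dvd (s : seq nat) (m : nat) :
  uniq s -> all prime s -> (\prod_(p <- s) p ^ logn p m %| m)%N.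
Proof.
elim: s => [|p s IH]; first by rewrite big_nil dvd1n.
rewrite big_cons /= => /andP[ps us] /andP[p_pr s_pr].
rewrite Gauss_dvd ?IH ?pfactor_dvdnn ?us //.
rewrite big_seq; elim/big_rec: _ => [|l y ls cop]; first by rewrite coprimen1.
rewrite coprimeMr cop andbT coprimeXl // coprimeXr // prime_coprime //.
rewrite dvdn_prime2 ?(allP s_pr l) //; by apply: contra ps => /eqP->.
Qed.

Lemma prod_primes_logn (q : nat) : (0 < q)%N ->
  (\prod_(p <- primes q) p ^ logn p q)%N = q.
Proof. by move=> q_gt0; rewrite {3}(prod_prime_decomp q_gt0) prime_decompE big_map. Qed.

Lemma ln_prod_pow (R : realType) (s : seq nat) (a : nat -> nat) :
  all prime s ->
  \sum_(p <- s) (a p)%:R * ln (p%:R : R) = ln ((\prod_(p <- s) p ^ a p)%N%:R).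
Proof.
move=> s_pr; have pos p : p \in s -> 0 < (p%:R : R).
  by move=> /(allP s_pr)/prime_gt0; rewrite ltr0n.
have [] // : \sum_(p <- s) (a p)%:R * ln (p%:R : R) = ln ((\prod_(p <- s) p ^ a p)%N%:R)
  /\ 0 < ((\prod_(p <- s) p ^ a p)%N%:R : R).
rewrite !big_seq; elim/big_rec2: _ => [|p y z ps [-> z_gt0]]; first by rewrite ln1.
have pa_gt0 : 0 < (p ^ a p)%:R :> R by rewrite natrX exprn_gt0 ?pos.
rewrite natrM lnM ?posrE // mulr_gt0 // natrX lnXn ?pos //.
by rewrite mulr_natl.
Qed.

Lemma omega_gt0 (q : nat) : (1 < q)%N -> (0 < omega q)%N.
Proof.
by move=> q_gt1; rewrite /omega -has_predT; apply/hasP; exists (pdiv q) => //;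
  rewrite mem_primes pdiv_prime // pdiv_dvd (ltnW q_gt1).
Qed.

(** * Obtuse systems of vectors *)

Lemma nonzero_relation (F : fieldType) (T K : finType) (a : T -> K -> F) :
  (#|K| < #|T|)%N ->
  exists2 c : T -> F, (exists t, c t != 0) & forall k, \sum_t c t * a t k = 0.
Proof.
move=> ltKT.
pose A : 'M[F]_(#|T|, #|K|) := \matrix_(i, j) a (enum_val i) (enum_val j).
have kerA : kermx A != 0.
  rewrite -mxrank_eq0 mxrank_ker -lt0n subn_gt0.
  exact: leq_ltn_trans (rank_leq_col A) ltKT.
have [i] := rowV0Pn kerA.
case=> i_ker i0; have /rV0Pn[j ij] := i0.
exists (fun t => i 0 (enum_rank t)).
  by exists (enum_val j); rewrite enum_valK.
move=> k; have /sub_kermxP/rowP/(_ (enum_rank k)) := i_ker.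
rewrite !mxE => h; rewrite -[RHS]h (reindex_onto enum_rank enum_val) /=;
  last by move=> *; rewrite enum_valK.
apply: eq_big => [t|t _]; first by rewrite enum_rankK eqxx.
by rewrite mxE !enum_rankK.
Qed.

(** Split [c] into its positive and negative parts.  As [K c = 0], the energy of
the positive part is its pairing with the negative part, whose support is
disjoint; an obtuse kernel makes this pairing negative unless one part
vanishes, and the condition that [c] has sum zero then makes both vanish. *)
Lemma obtuse_no_relation (R : realFieldType) (T : finType) (K : T -> T -> R) (c : T -> R) :
  (forall w : T -> R, 0 <= \sum_i \sum_j w i * w j * K i j) ->
  (forall i j, i != j -> K i j < 0) ->
  \sum_i c i = 0 -> (forall i, \sum_j K i j * c j = 0) -> forall i, c i = 0.
Proof.
move=> psd obtuse sumc Kc.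
pose pos i := Num.max (c i) 0; pose neg i := Num.max (- c i) 0.
have pos_ge0 i : 0 <= pos i by rewrite le_max lexx orbT.
have neg_ge0 i : 0 <= neg i by rewrite le_max lexx orbT.
have cE i : c i = pos i - neg i.
  by rewrite /pos /neg !maxEle; case: ifP; case: ifP; lra.
have posneg i : pos i * neg i = 0.
  by rewrite /pos /neg !maxEle; case: ifP; case: ifP; nra.
have term_le0 i j : pos i * neg j * K i j <= 0.
  have [->|/obtuse Kij] := eqVneq i j; first by rewrite posneg mul0r.
  by rewrite mulr_ge0_le0 ?mulr_ge0 // ltW.
have sum_ge0 : 0 <= \sum_i \sum_j pos i * neg j * K i j.
  suff -> : \sum_i \sum_j pos i * neg j * K i j = \sum_i \sum_j pos i * pos j * K i j by [].
  apply: eq_bigr => i _; apply/esym/eqP; rewrite -subr_eq0 -sumrB.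
  rewrite (eq_bigr (fun j => pos i * (K i j * c j))) => [|j _]; last by rewrite (cE j); ring.
  by rewrite -mulr_sumr Kc mulr0.
have sum_eq : \sum_i pos i = \sum_i neg i.
  apply/eqP; rewrite -subr_eq0 -sumrB; apply/eqP; rewrite -[RHS]sumc.
  by apply: eq_bigr => i _; rewrite cE.
have pos0 i : pos i = 0.
  have [//|pi] := eqVneq (pos i) 0.
  have pi_gt0 : 0 < pos i by rewrite lt_def pi pos_ge0.
  have [j nj] : exists j, neg j != 0.
    apply/existsP; apply: contraT => /existsPn all0.
    have : 0 < \sum_i pos i by rewrite (bigD1 i) //= ltr_pwDl // sumr_ge0.
    by rewrite sum_eq big1 ?ltxx // => j _; apply/eqP; have := all0 j; rewrite negbK.
  have nj_gt0 : 0 < neg j by rewrite lt_def nj neg_ge0.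
  have ij : i != j by apply: contraNneq pi => ->; rewrite -(mulIr_eq0 _ (mulIf nj)) posneg.
  have := sum_ge0; rewrite leNgt; case/negP.
  rewrite (bigD1 i) //= (bigD1 j) //= -addrA ltr_wnDr //.
    rewrite -[X in _ <= X]addr0 lerD //; first by apply: sumr_le0.
    by apply: sumr_le0 => ? _; apply: sumr_le0.
  by rewrite pmulr_rlt0 ?obtuse // mulr_gt0.
move=> i; rewrite cE pos0 sub0r; apply/eqP; rewrite oppr_eq0.
have : \sum_i neg i = 0 by rewrite -sum_eq big1.
by move/psumr_eq0P => -> //.
Qed.

(** * Interpolation at the roots modulo a prime power *)

(** Lagrange's formula multiplied by the product of all the denominators, so
that it holds over the integers: both sides have degree less than [#|A|] and
agree on the points of [A]. *)
Lemma lagrange_int (T : finType) (x : T -> int) (A : {set T}) (P : {poly int}) :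
  injective x -> (size P <= #|A|)%N ->
  (\prod_(i in A) \prod_(j in A :\ i) (x i - x j)) *: P =
  \sum_(i in A)
    (P.[x i] * \prod_(k in A :\ i) \prod_(j in A :\ k) (x k - x j)) *:
      \prod_(j in A :\ i) ('X - (x j)%:P).
Proof.
move=> x_inj sizeP; apply/eqP; rewrite -subr_eq0; apply/eqP.
set Q := _ - _.
apply: (@roots_geq_poly_eq0 _ _ [seq x i | i in A]); last first.
- rewrite size_image; apply: leq_trans (size_polyD _ _) _.
  rewrite size_polyN geq_max (leq_trans (size_scale_leq _ _)) //=.
  apply: leq_trans (size_sum _ _ _) _; apply/bigmax_leqP => i iA.
  apply: leq_trans (size_scale_leq _ _) _.
  by rewrite -big_enum /= size_prod_XsubC -cardE (cardsD1 i A) iA.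
- by rewrite map_inj_uniq ?enum_uniq.
apply/allP => _ /fintype.imageP[k kA ->]; rewrite /root /Q !hornerE horner_sum.
rewrite [X in _ - X](bigD1 k) //= [X in _ - (_ + X)]big1; last first.
  move=> i /andP[iA ik]; rewrite hornerZ horner_prod [X in _ * X](bigD1 k) /=.
    by rewrite hornerXsubC subrr mul0r mulr0.
  by rewrite !inE eq_sym ik.
rewrite addr0 hornerZ horner_prod subr_eq0.
rewrite [X in _ == _ * X](eq_bigr (fun j => x k - x j)); last by move=> j _; rewrite hornerXsubC.
by rewrite (big_setD1 k) //=; apply/eqP; ring.
Qed.

(** If [p ^ e] divided none of the denominators of Lagrange's formula, each
coefficient [P.[x i] / \prod_j (x i - x j)] would have positive valuation at
[p], and [p] would divide every coefficient of [P]. *)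
Lemma interpolation_dvd (T : finType) (x : T -> int) (A : {set T})
    (P : {poly int}) (p e k : nat) :
  injective x -> prime p -> (size P <= #|A|)%N -> ~~ (p %| `|(P`_k)%R|)%N ->
  (forall i, i \in A -> (p ^ e %| `|P.[x i]%R|)%N) ->
  exists2 i, i \in A & (p ^ e %| \prod_(j in A :\ i) `|x i - x j|)%N.
Proof.
move=> x_inj p_pr sizeP pPk rootP.
pose D i := \prod_(j in A :\ i) (x i - x j).
have absD i : `|D i|%N = (\prod_(j in A :\ i) `|x i - x j|)%N.
  by rewrite /D (big_morph absz abszM absz1).
have D_gt0 i : (0 < `|D i|)%N.
  rewrite absz_gt0 /D; apply/prodf_neq0 => j; rewrite !inE => /andP[ji _].
  by rewrite subr_eq0 (inj_eq x_inj) eq_sym.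
pose M i := (\prod_(j in A :\ i) `|D j|)%N.
have M_gt0 i : (0 < M i)%N by apply: prodn_gt0.
pose m := (\prod_(j in A) `|D j|)%N.
have m_gt0 : (0 < m)%N by apply: prodn_gt0.
have mE i : i \in A -> m = (`|D i| * M i)%N by move=> iA; rewrite /m (big_setD1 i).
apply/exists_inP; apply: contraT => /exists_inPn noD.
have dvdM i : i \in A -> (p ^ (logn p m).+1 %| `|P.[x i]%R| * M i)%N.
  move=> iA; have := noD i iA; rewrite -absD pfactor_dvdn // -ltnNge => lt_e.
  rewrite (mE i iA) lognM // -addSn addnC expnD mulnC.
  rewrite dvdn_mul ?pfactor_dvdnn //.
  by apply: dvdn_trans (rootP i iA); rewrite dvdn_exp2l.
have : (p ^ (logn p m).+1 %| m * `|(P`_k)%R|)%N.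
  have -> : (m * `|(P`_k)%R|)%N = `|(((\prod_(i in A) D i) *: P)`_k)%R|%N.
    by rewrite coefZ abszM (big_morph absz abszM absz1).
  rewrite (lagrange_int x_inj sizeP) coef_sum.
  rewrite -(dvdzE (p ^ _)%:Z); apply: rpred_sum => i iA.
  rewrite coefZ dvdz_mulr // dvdzE abszM.
  by rewrite [X in (_ * X)%N](big_morph absz abszM absz1); apply: dvdM.
have Pk_gt0 : (0 < `|(P`_k)%R|)%N by rewrite lt0n; apply: contraNneq pPk => ->.
rewrite pfactor_dvdn ?muln_gt0 ?m_gt0 // lognM // -addn1 leq_add2l.
by rewrite logn_gt0 mem_primes p_pr Pk_gt0 (negPf pPk).
Qed.

Lemma exists_set_card (T : finType) (m : nat) :
  (m <= #|T|)%N -> exists A : {set T}, #|A| = m.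
Proof.
rewrite -bin_gt0 -card_draws => /card_gt0P[A].
by rewrite inE => /eqP; exists A.
Qed.

(** For a symmetric function [t] with diagonal [e], choose [Y] of cardinal [n]
with least total energy.  Given [x] outside [Y], minimality says that
exchanging [y] for [x] does not lower the energy, that is, [x] interacts with
[Y :\ y] at least as much as [y] does.  So if it is some [y] that is crowded in
[x |: Y], then [x] is crowded by [Y] too. *)
Lemma fekete_cover (T : finType) (t : T -> T -> nat) (e n : nat) :
  (forall i j, t i j = t j i) -> (forall i, t i i = e) -> (n <= #|T|)%N ->
  (forall A : {set T}, #|A| = n.+1 ->
     exists2 i, i \in A & (e <= \sum_(j in A :\ i) t i j)%N) ->
  exists2 Y : {set T}, #|Y| = n & forall i, (e <= \sum_(j in Y) t i j)%N.
Proof.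
move=> t_sym t_diag n_le crowded.
pose energy (Y : {set T}) := (\sum_(i in Y) \sum_(j in Y) t i j)%N.
have [Y0 Y0n] := exists_set_card n_le.
have [Y /eqP Yn Ymin] := @arg_minnP _ Y0 (fun Y : {set T} => #|Y| == n) energy (introT eqP Y0n).
exists Y => // x.
have [xY|xY] := boolP (x \in Y).
  by rewrite (bigD1 x) //= t_diag leq_addr.
have energyU1 (Z : {set T}) z : z \notin Z ->
    energy (z |: Z) = (e + (\sum_(j in Z) t z j).*2 + energy Z)%N.
  move=> zZ; rewrite /energy big_setU1 //= big_setU1 //= t_diag.
  under [X in (_ + X)%N]eq_bigr do rewrite big_setU1 //=.
  rewrite big_split /=.
  under [X in (_ + (X + _))%N]eq_bigr do rewrite t_sym.
  by rewrite -addnn; lia.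
have exch y : y \in Y -> (\sum_(j in Y :\ y) t y j <= \sum_(j in Y :\ y) t x j)%N.
  move=> yY; have xY' : x \notin Y :\ y by rewrite in_setD1 negb_and xY orbT.
  have := Ymin (x |: (Y :\ y)).
  rewrite cardsU1 xY' -Yn (cardsD1 y Y) yY eqxx => /(_ isT).
  by rewrite -{1}(finset.setD1K yY) !energyU1 ?finset.setD11 // -!addnn; lia.
have [|i] := crowded (x |: Y); first by rewrite cardsU1 xY Yn.
rewrite in_setU1 => /predU1P[->|iY]; first by rewrite finset.setU1K.
have -> : (x |: Y) :\ i = x |: (Y :\ i).
  apply/setP=> z; rewrite !inE; case: (eqVneq z x) => [->|] //=.
  by rewrite andbT; apply/eqP => xi; rewrite xi iY in xY.
rewrite big_setU1 /=; last by rewrite in_setD1 negb_and xY orbT.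
move=> le_e; apply: (leq_trans le_e).
by rewrite [leqRHS](big_setD1 i) //= t_sym leq_add2l exch.
Qed.

(** * The kernel of a chain of equivalence relations *)

Section RefinementKernel.
(** In the application [r k] is congruence modulo [p ^ k.+1], so that
[\sum_(k < e) r k i j] is the valuation of the difference, truncated at [e].
Going down the chain from a point [i], [depth i k] is the sum over [Y] of the
valuations of the differences with [i], truncated at [k]; [gain] is its
increment capped at total [e], and [theta k i] spreads this increment over the
points of [Y] in the class of [i].  As it depends only on that class, the
weighted sum [G] of the relations is symmetric and positive semidefinite.

With a continuous level parameter this would be the kernel
[min (rho i, valuation)], for [rho i] the radius at which the ball around [i]
has potential exactly [e] against [Y]; the fractional weight of the last level
replaces the fractional part of this radius. *)
Variables (R : realFieldType) (T : finType) (r : nat -> rel T).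
Variables (e n : nat) (Y : {set T}).
Hypothesis r_equiv : forall k, equivalence_rel (r k).
Hypothesis r_sub : forall l k i j, (l <= k)%N -> r k i j -> r l i j.
Hypothesis cardY : #|Y| = n.
Hypothesis n_gt0 : (0 < n)%N.
Hypothesis e_gt0 : (0 < e)%N.
Hypothesis coverY : forall i, (e <= \sum_(j in Y) \sum_(k < e) r k i j)%N.

Let blockY k i := (\sum_(j in Y) r k i j)%N.
Let depth i k := (\sum_(l < k) blockY l i)%N.
Let gain k i : R := (minn e (depth i k.+1))%:R - (minn e (depth i k))%:R.
Let theta k i : R := gain k i / (blockY k i)%:R.
Let G i j : R := \sum_(k < e) theta k i * (r k i j)%:R.

Let r_refl k i : r k i i.
Proof. by have [] := r_equiv k i i i. Qed.

Let r_congr k i j h : r k i j -> r k i h = r k j h.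
Proof. by have [_] := r_equiv k i j h; apply. Qed.

Let r_sym k i j : r k i j = r k j i.
Proof.
by apply/idP/idP => rij; [rewrite -(r_congr i rij)|rewrite -(r_congr j rij)]; apply: r_refl.
Qed.

Let depthS i k : depth i k.+1 = (depth i k + blockY k i)%N.
Proof. by rewrite /depth big_ord_recr. Qed.

Let depth_leq i k l : (k <= l)%N -> (depth i k <= depth i l)%N.
Proof.
elim: l => [|l IH]; first by rewrite leqn0 => /eqP->.
by rewrite leq_eqVlt => /predU1P[->//|]; rewrite depthS => /IH; lia.
Qed.

Let blockY_congr k i j : r k i j -> blockY k i = blockY k j.
Proof. by move=> rij; apply: eq_bigr => h _; rewrite (r_congr h rij). Qed.

Let depth_congr k i j : r k i j -> depth i k.+1 = depth j k.+1.
Proof.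
move=> rij; apply: eq_bigr => l _; apply: blockY_congr.
by apply: r_sub rij; rewrite -ltnS.
Qed.

Let theta_congr k i j : r k i j -> theta k i = theta k j.
Proof.
move=> rij; have B := blockY_congr rij; have := depth_congr rij.
by rewrite /theta /gain !depthS B => /addIn->.
Qed.

Let depth_e i : (e <= depth i e)%N.
Proof. by rewrite /depth /blockY exchange_big. Qed.

Let gain_ge0 k i : 0 <= gain k i.
Proof. rewrite subr_ge0 ler_nat depthS; lia. Qed.

Let theta_ge0 k i : 0 <= theta k i.
Proof. by rewrite mulr_ge0 ?gain_ge0 // invr_ge0. Qed.

Let theta_le1 k i : theta k i <= 1.
Proof.
rewrite /theta; have [->|N0] := eqVneq (blockY k i) 0%N; first by rewrite invr0 mulr0.
rewrite ler_pdivrMr ?ltr0n ?lt0n // mul1r lerBlDr -natrD ler_nat depthS; lia.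
Qed.

Let thetaM k i : theta k i * (blockY k i)%:R = gain k i.
Proof.
have [B0|N0] := eqVneq (blockY k i) 0%N; last by rewrite divfK // pnatr_eq0.
by rewrite /gain depthS B0 addn0 subrr mulr0.
Qed.

Let G_sym i j : G i j = G j i.
Proof.
apply: eq_bigr => k _; rewrite (r_sym k j i).
by have [rij|] := boolP (r k i j); rewrite ?mulr0 // (theta_congr rij).
Qed.

Let G_le i j : G i j <= (\sum_(k < e) r k i j)%:R.
Proof.
by rewrite natr_sum; apply: ler_sum => k _; rewrite ler_piMl ?theta_le1.
Qed.

(** [Y] is in equilibrium for [G]: the sum over [Y] telescopes to the capped
depth at the bottom of the chain, which is [e] by the covering hypothesis. *)
Let G_rowY i : \sum_(j in Y) G i j = e%:R.
Proof.
rewrite exchange_big /=.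
under eq_bigr do rewrite -mulr_sumr -natr_sum thetaM.
rewrite -(big_mkord xpredT (fun k => gain k i)) telescope_sumr //.
by rewrite /depth big_ord0 minn0 subr0 (minn_idPl (depth_e i)).
Qed.

(** For one relation, the form is the sum over classes of [theta] times the
square of the mass of [w] on the class.  It is written as a sum over points,
each point taking a share [1 / m] of its class of size [m]. *)
Let G_psd (w : T -> R) : 0 <= \sum_i \sum_j w i * w j * G i j.
Proof.
pose s k i := \sum_j (r k i j)%:R * w j.
pose m k i : R := \sum_j (r k i j)%:R.
have m_gt0 k i : 0 < m k i.
  rewrite /m (bigD1 i) //= r_refl ltr_pwDl // sumr_ge0 // => j _; exact: ler0n.
have -> : \sum_i \sum_j w i * w j * G i j
    = \sum_(k < e) \sum_i theta k i * (s k i) ^+ 2 / m k i; last first.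
  apply: sumr_ge0 => k _; apply: sumr_ge0 => i _.
  have h1 := theta_ge0 k i; have h2 := ltW (m_gt0 k i).
  by rewrite (mulr_ge0 (mulr_ge0 h1 (sqr_ge0 _))) // invr_ge0.
transitivity (\sum_(k < e) \sum_i w i * theta k i * s k i).
  rewrite [RHS]exchange_big; apply: eq_bigr => i _ /=.
  under eq_bigr do rewrite mulr_sumr.
  rewrite exchange_big; apply: eq_bigr => k _ /=.
  by rewrite mulr_sumr; apply: eq_bigr => j _; ring.
apply: eq_bigr => k _.
have s_congr i j : r k i j -> s k i = s k j.
  by move=> rij; apply: eq_bigr => h _; rewrite (r_congr h rij).
have m_congr i j : r k i j -> m k i = m k j.
  by move=> rij; apply: eq_bigr => h _; rewrite (r_congr h rij).
transitivity (\sum_i \sum_j (r k i j)%:R * (w j * theta k j * s k j / m k j)).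
  rewrite exchange_big; apply: eq_bigr => j _ /=.
  rewrite -mulr_suml (eq_bigr (fun i => (r k j i)%:R)); last by move=> i _; rewrite r_sym.
  by rewrite -/(m k j) [RHS]mulrC divfK // gt_eqF.
apply: eq_bigr => i _.
rewrite expr2 mulrA -[s k i as X in _ * X / _]/(\sum_j (r k i j)%:R * w j).
rewrite mulr_sumr mulr_suml; apply: eq_bigr => j _.
have [rij|_] := boolP (r k i j); last by rewrite !mul0r mulr0 mul0r.
rewrite (theta_congr rij) (s_congr _ _ rij) (m_congr _ _ rij); ring.
Qed.

(** [G i] only sees the classes of [i] above the level where the depth reaches
[e]; the class at the last such level gained something, so it meets [Y], at a
point that has the same classes and the same weights as [i]. *)
Let G_row_mem i : exists2 y, y \in Y & forall j, G i j = G y j.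
Proof.
have exK : exists k, (e <= depth i k)%N by exists e; apply: depth_e.
have [[|K] eK Kmin] := ex_minnP exK.
  by move: eK; rewrite /depth big_ord0; lia.
have ltK : (depth i K < e)%N by rewrite ltnNge; apply/negP => /Kmin; rewrite ltnn.
have [y yY riy] : exists2 y, y \in Y & r K i y.
  have : (0 < blockY K i)%N by move: eK; rewrite depthS; lia.
  rewrite lt0n sum_nat_eq0 negb_forall => /existsP[y].
  by rewrite negb_imply => /andP[yY]; rewrite eqb0 negbK; exists y.
exists y => // j; apply: eq_bigr => k _.
have [kK|Kk] := leqP k K.
  have rk := r_sub kK riy; by rewrite (theta_congr rk) (r_congr _ rk).
have gain0 h : (e <= depth h K.+1)%N -> gain k h = 0.
  move=> eh; have e1 := leq_trans eh (depth_leq h Kk).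
  have e2 := leq_trans e1 (depth_leq h (leqnSn k)).
  by rewrite /gain (minn_idPl e1) (minn_idPl e2) subrr.
by rewrite /theta !gain0 ?mul0r // -(depth_congr riy).
Qed.

(** Testing [G] on [w - (s / n) 1_Y], where [s] is the total mass of [w], gives
positivity of [G - e / n], because the sums of [G] over [Y] all equal [e].
Every row of this kernel is one of its rows at a point of [Y], and these [n]
rows add up to zero, so [n - 1] of them suffice to test that a vector is in the
null space. *)
Lemma refinement_kernel : exists K : T -> T -> R,
  [/\ forall w : T -> R, 0 <= \sum_i \sum_j w i * w j * K i j,
      forall i j, K i j <= (\sum_(k < e) r k i j)%:R - e%:R / n%:R
    & exists2 Z : {set T}, #|Z| = n.-1 &
        forall c : T -> R, (forall z, z \in Z -> \sum_j K z j * c j = 0) ->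
          forall i, \sum_j K i j * c j = 0].
Proof.
have n_neq0 : n%:R != 0 :> R by rewrite pnatr_eq0 -lt0n.
(* The row at [y0] is minus the sum of the rows at the other points of [Y]. *)
have [y0 y0Y] : exists y0, y0 \in Y by apply/set0Pn; rewrite -card_gt0 cardY.
pose lam : R := e%:R / n%:R.
have lamn : lam * n%:R = e%:R by rewrite /lam divfK.
exists (fun i j => G i j - lam); split.
- move=> w; set s := \sum_i w i.
  pose u j : R := if j \in Y then s / n%:R else 0.
  have sumu (f : T -> R) : \sum_j u j * f j = s / n%:R * \sum_(j in Y) f j.
    rewrite mulr_sumr [RHS]big_mkcond /=; apply: eq_bigr => j _.
    by rewrite /u; case: ifP => _; rewrite ?mul0r.
  have Gu i : \sum_j u j * G i j = s * lam.
    by rewrite sumu G_rowY /lam; ring.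
  have := G_psd (fun i => w i - u i).
  have -> : \sum_i \sum_j (w i - u i) * (w j - u j) * G i j =
     \sum_i \sum_j w i * w j * G i j - 2%:R * (\sum_i w i * \sum_j u j * G i j)
     + \sum_i u i * \sum_j u j * G i j.
    transitivity (\sum_i (\sum_j w i * w j * G i j - 2%:R * (w i * \sum_j u j * G i j)
       + u i * \sum_j u j * G i j + (w i * (\sum_j u j * G i j) - u i * (\sum_j w j * G i j)))).
      apply: eq_bigr => i _; rewrite !mulr_sumr -!sumrN -!big_split /=.
      by apply: eq_bigr => j _; ring.
    rewrite !big_split /= !sumrN -mulr_sumr; set B := (X in _ + (_ - X)).
    rewrite -[RHS]addr0; congr (_ + _); apply/eqP; rewrite subr_eq0; apply/eqP.
    rewrite /B; under eq_bigr do rewrite mulr_sumr.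
    rewrite exchange_big /=; apply: eq_bigr => i _.
    by rewrite mulr_sumr; apply: eq_bigr => j _; rewrite G_sym; ring.
  under [X in _ - 2%:R * X]eq_bigr do rewrite Gu.
  under [X in _ + X]eq_bigr do rewrite Gu.
  rewrite -!mulr_suml -/s.
  have -> : \sum_i u i = s.
    under eq_bigr do rewrite -[u _]mulr1.
    by rewrite sumu sumr_const cardY divfK.
  have -> : \sum_i \sum_j w i * w j * (G i j - lam) =
     \sum_i \sum_j w i * w j * G i j - s * (s * lam).
    under eq_bigr do under eq_bigr do rewrite mulrBr.
    under eq_bigr do rewrite sumrB.
    rewrite sumrB; congr (_ - _).
    rewrite /s mulr_suml; apply: eq_bigr => i _.
    by rewrite -mulr_suml -mulr_sumr mulrA.
  by move=> h; lra.
- by move=> i j; rewrite lerD2r G_le.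
exists (Y :\ y0); first by rewrite -cardY (cardsD1 y0 Y) y0Y.
move=> c cZ.
have sumY : \sum_(y in Y) \sum_j (G y j - lam) * c j = 0.
  rewrite exchange_big big1 //= => j _; rewrite -mulr_suml sumrB.
  under eq_bigr do rewrite G_sym.
  by rewrite G_rowY sumr_const cardY -(mulr_natr lam) lamn subrr mul0r.
have cY y : y \in Y -> \sum_j (G y j - lam) * c j = 0.
  have [->|yy0 yY] := eqVneq y y0; last by apply: cZ; rewrite !inE yy0.
  move=> _; move: sumY; rewrite (big_setD1 y0) //= [X in _ + X]big1 ?addr0 //.
move=> i; have [y yY Giy] := G_row_mem i.
by rewrite -[RHS](cY y yY); apply: eq_bigr => j _; rewrite Giy.
Qed.
End RefinementKernel.

(** * Roots modulo q *)

(** The kernel of the chain of congruences modulo the powers of [p].  The set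
[Z] records that its rank is less than [n]. *)
Lemma root_kernel (R : realFieldType) (T : finType) (x : T -> int)
    (P : {poly int}) (p e n l : nat) :
  injective x -> prime p -> (0 < e)%N -> (0 < n)%N -> (n <= #|T|)%N ->
  (size P <= n.+1)%N -> ~~ (p %| `|(P`_l)%R|)%N ->
  (forall i, (p ^ e %| `|P.[x i]%R|)%N) ->
  exists K : T -> T -> R, exists Z : {set T},
  [/\ forall w : T -> R, 0 <= \sum_i \sum_j w i * w j * K i j,
      forall i j, i != j -> K i j <= (logn p `|x i - x j|%N)%:R - e%:R / n%:R,
      #|Z| = n.-1 &
      forall c : T -> R, (forall z, z \in Z -> \sum_j K z j * c j = 0) ->
          forall i, \sum_j K i j * c j = 0].
Proof.
move=> x_inj p_pr e_gt0 n_gt0 n_le sizeP pPl rootP.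
pose r k i j := (p ^ k.+1 %| `|x i - x j|)%N.
have dist_gt0 i j : i != j -> (0 < `|x i - x j|)%N.
  by move=> ij; rewrite absz_gt0 subr_eq0 (inj_eq x_inj).
have rE k i j : r k i j = (x i == x j %[mod (p ^ k.+1)%N%:Z])%Z.
  by rewrite eqz_mod_dvd.
have r_equiv k : equivalence_rel (r k).
  by move=> i j h; rewrite !rE eqxx; split=> // /eqP->.
have r_sub a b i j : (a <= b)%N -> r b i j -> r a i j.
  by move=> ab; apply: dvdn_trans; rewrite dvdn_exp2l.
pose t i j := (\sum_(k < e) r k i j)%N.
have t_sym i j : t i j = t j i by apply: eq_bigr => k _; rewrite /r distnC.
have t_diag i : t i i = e.
  rewrite /t (eq_bigr (fun=> 1%N)) ?sum1_card ?card_ord // => k _.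
  by rewrite /r subrr dvdn0.
have crowded (A : {set T}) : #|A| = n.+1 ->
    exists2 i, i \in A & (e <= \sum_(j in A :\ i) t i j)%N.
  move=> cardA.
  have [|i iA] := interpolation_dvd x_inj p_pr _ pPl (A := A) (fun i _ => rootP i).
    by rewrite cardA.
  have dist_gt0' j : j \in A :\ i -> (0 < `|x i - x j|)%N.
    by rewrite !inE eq_sym => /andP[/dist_gt0].
  rewrite pfactor_dvdn // ?prodn_cond_gt0 // logn_prod // => e_le.
  exists i => //; apply: leq_trans (leq_sum_minn e_le) _.
  by apply: leq_sum => j jA; rewrite -sum_dvd_exp ?dist_gt0'.
have [Y cardY coverY] := fekete_cover t_sym t_diag n_le crowded.
have [K [psd K_le [Z cardZ KZ]]] :=
  refinement_kernel R r_equiv r_sub cardY n_gt0 e_gt0 coverY.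
exists K, Z; split=> // i j ij.
apply: le_trans (K_le i j) _; rewrite lerD2r ler_nat.
by rewrite sum_dvd_exp ?dist_gt0 // geq_minr.
Qed.

Lemma coef_not_dvd (P : {poly int}) (q p : nat) :
  gcdn (coef_gcd P) q = 1%N -> p \in primes q ->
  exists l, ~~ (p %| `|(P`_l)%R|)%N.
Proof.
move=> gcdPq; rewrite mem_primes => /and3P[p_pr _ pq].
have [/existsP[i pi]|nodvd] := boolP [exists i : 'I_(size P), ~~ (p %| `|(P`_i)%R|)%N].
  by exists i.
have : (p %| gcdn (coef_gcd P) q)%N.
  rewrite dvdn_gcd pq andbT /coef_gcd.
  elim/big_rec: _ => [|i y _ py]; first exact: dvdn0.
  rewrite dvdn_gcd py andbT.
  by move: nodvd; rewrite negb_exists => /forallP/(_ i); rewrite negbK.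
by rewrite gcdPq dvdn1 => /eqP p1; rewrite p1 in p_pr.
Qed.

(** A nonzero vector of sum zero on which all the kernels of the primes dividing
[q] vanish exists as soon as there are more roots than the
[1 + (n - 1) * omega q] conditions; the sum of the kernels with weights [ln p]
is obtuse, so such a vector cannot exist. *)
Lemma close_roots_card (R : realType) (T : finType) (x : T -> int)
    (P : {poly int}) (n q : nat) :
  (1 < n)%N -> (1 < q)%N -> injective x -> (size P <= n.+1)%N ->
  gcdn (coef_gcd P) q = 1%N ->
  (forall i, (q %| `|P.[x i]%R|)%N) ->
  (forall i j, (`|x i - x j| ^ n < q)%N) ->
  (#|T| <= n.-1 * omega q + 1)%N.
Proof.
move=> n_gt1 q_gt1 x_inj sizeP gcdPq rootP close.
have w_gt0 := omega_gt0 q_gt1.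
rewrite leqNgt; apply/negP => T_gt.
have n_gt0 := ltnW n_gt1; have q_gt0 := ltnW q_gt1.
have n_le : (n <= #|T|)%N.
  have := leq_pmulr n.-1 w_gt0; lia.
pose p (u : 'I_(omega q)) := nth 0%N (primes q) u.
have p_mem u : p u \in primes q by rewrite mem_nth.
have p_pr u : prime (p u) by have := p_mem u; rewrite mem_primes => /andP[].
have sum_p (f : nat -> R) : \sum_u f (p u) = \sum_(l <- primes q) f l.
  by rewrite (big_nth 0%N) big_mkord.
have kernels u : exists KZ : (T -> T -> R) * {set T},
  [/\ forall w : T -> R, 0 <= \sum_i \sum_j w i * w j * KZ.1 i j,
      forall i j, i != j ->
        KZ.1 i j <= (logn (p u) `|x i - x j|%N)%:R - (logn (p u) q)%:R / n%:R,
      #|KZ.2| = n.-1 &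
      forall c : T -> R, (forall z, z \in KZ.2 -> \sum_j KZ.1 z j * c j = 0) ->
          forall i, \sum_j KZ.1 i j * c j = 0].
  have [l pl] := coef_not_dvd gcdPq (p_mem u).
  have [|i|K [Z KZ]] := root_kernel R x_inj (p_pr u) _ n_gt0 n_le sizeP pl (e := logn (p u) q).
  - by rewrite logn_gt0.
  - by apply: dvdn_trans (rootP i); rewrite pfactor_dvdnn.
  - by exists (K, Z).
have [KZ KZP] := fin_all_exists kernels.
pose K u := (KZ u).1; pose Z u := (KZ u).2.
(* The conditions: [None] stands for total mass zero, [Some (u, z)] for the row
at [z] of the kernel of the prime [p u]. *)
pose C := option {uz : 'I_(omega q) * T | uz.2 \in Z uz.1}.
have cardC : #|{: C}| = (omega q * n.-1).+1.
  rewrite card_option card_sig; congr S.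
  transitivity (\sum_u #|Z u|)%N.
    rewrite -sum1_card; under [RHS]eq_bigr do rewrite -sum1_card.
    by rewrite pair_big_dep /=.
  rewrite (eq_bigr (fun=> n.-1)); last by move=> u _; have [] := KZP u.
  by rewrite sum_nat_const card_ord.
pose a t (k : C) : R := if k is Some uz then K (val uz).1 (val uz).2 t else 1.
have [|c [t ct0] ca] := nonzero_relation a.
  by rewrite cardC mulnC -addn1.
pose Ktot i j := \sum_u ln (p u)%:R * K u i j.
have lnp_ge0 u : 0 <= ln (p u)%:R :> R by rewrite ln_ge0 // ler1n prime_gt0.
suff c0 : forall i, c i = 0 by rewrite c0 eqxx in ct0.
apply: (@obtuse_no_relation _ _ Ktot).
- move=> w; suff -> : \sum_i \sum_j w i * w j * Ktot i j =
    \sum_u ln (p u)%:R * \sum_i \sum_j w i * w j * K u i j.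
    by apply: sumr_ge0 => u _; rewrite mulr_ge0 //; have [] := KZP u.
  under [RHS]eq_bigr do rewrite mulr_sumr.
  rewrite [RHS]exchange_big; apply: eq_bigr => i _ /=.
  under [RHS]eq_bigr do rewrite mulr_sumr.
  rewrite [RHS]exchange_big; apply: eq_bigr => j _ /=.
  by rewrite mulr_sumr; apply: eq_bigr => u _; ring.
- move=> i j ij.
  have d_gt0 : (0 < `|x i - x j|)%N by rewrite absz_gt0 subr_eq0 (inj_eq x_inj).
  set d := `|x i - x j|%N in d_gt0.
  have nR_gt0 : 0 < n%:R :> R by rewrite ltr0n.
  have dR_gt0 : 0 < d%:R :> R by rewrite ltr0n.
  have pr_all : all prime (primes q) by apply/allP => l; rewrite mem_primes => /andP[].
  have : Ktot i j <= ln d%:R - ln q%:R / n%:R.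
    apply: (@le_trans _ _ (\sum_u ln (p u)%:R * ((logn (p u) d)%:R - (logn (p u) q)%:R / n%:R))).
      by apply: ler_sum => u _; rewrite ler_wpM2l //; have [_ /(_ i j ij)] := KZP u.
    have -> : \sum_u ln (p u)%:R * ((logn (p u) d)%:R - (logn (p u) q)%:R / n%:R) =
      \sum_u (logn (p u) d)%:R * ln (p u)%:R - (\sum_u (logn (p u) q)%:R * ln (p u)%:R) / n%:R :> R.
      by rewrite mulr_suml -sumrB; apply: eq_bigr => u _; ring.
    rewrite (sum_p (fun l => (logn l d)%:R * ln l%:R)) (sum_p (fun l => (logn l q)%:R * ln l%:R)).
    rewrite !ln_prod_pow // prod_primes_logn // lerD2r ler_ln ?posrE ?ltr0n //; last first.
      by rewrite big_seq prodn_cond_gt0 // => l lq; rewrite expn_gt0 prime_gt0 // (allP pr_all).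
    by rewrite ler_nat dvdn_leq // prod_pfactor_dvd ?primes_uniq.
  move/le_lt_trans; apply.
  rewrite subr_lt0 ltr_pdivlMr // mulr_natr -lnXn // ltr_ln ?posrE ?exprn_gt0 ?ltr0n //.
  by rewrite -natrX ltr_nat close.
- by rewrite -[RHS](ca None); apply: eq_bigr => i _; rewrite mulr1.
move=> i; rewrite /Ktot; under eq_bigr do rewrite mulr_suml.
rewrite exchange_big big1 //= => u _.
under eq_bigr do rewrite -mulrA.
rewrite -mulr_sumr; have [_ _ _ KZ0] := KZP u.
rewrite KZ0 ?mulr0 // => z zZ.
rewrite -[RHS](ca (Some (exist _ (u, z) zZ))).
by apply: eq_bigr => j _; rewrite mulrC.
Qed.

(** Among [n + 1] roots, [q] would divide a product of [n] distances from one of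
them.  Each distance is at most [q ^ (1 / n)], and one is smaller: two roots
at the same extreme distance from a third lie on opposite sides of it, too far
from each other. *)
Lemma prime_power_roots_card (T : finType) (x : T -> int) (P : {poly int}) (n q : nat) :
  (1 < n)%N -> (1 < q)%N -> omega q = 1%N -> injective x -> (size P <= n.+1)%N ->
  gcdn (coef_gcd P) q = 1%N ->
  (forall i, (q %| `|P.[x i]%R|)%N) ->
  (forall i j, (`|x i - x j| ^ n <= q)%N) ->
  (#|T| <= n)%N.
Proof.
move=> n_gt1 q_gt1 w1 x_inj sizeP gcdPq rootP close.
have q_gt0 := ltnW q_gt1.
rewrite leqNgt; apply/negP => n_lt.
have [p primesq] : exists p, primes q = [:: p].
  by move: w1; rewrite /omega; case: (primes q) => [|p []] //; exists p.
have p_mem : p \in primes q by rewrite primesq inE.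
have p_pr : prime p by move: p_mem; rewrite mem_primes => /andP[].
have qE : q = (p ^ logn p q)%N by rewrite -{1}(prod_primes_logn q_gt0) primesq big_seq1.
have [l pl] := coef_not_dvd gcdPq p_mem.
have [A cardA] := exists_set_card n_lt.
have [||i iA] := interpolation_dvd x_inj p_pr _ pl (A := A) (e := logn p q).
- by rewrite cardA.
- by move=> i _; rewrite -qE.
pose d j := `|x i - x j|%N.
have d_gt0 j : j \in A :\ i -> (0 < d j)%N.
  by rewrite !inE eq_sym absz_gt0 subr_eq0 (inj_eq x_inj) => /andP[].
have cardAi : #|A :\ i| = n by move: cardA; rewrite (cardsD1 i A) iA add1n => -[].
rewrite -qE => /dvdn_leq; rewrite prodn_cond_gt0 // => /(_ isT).
apply/negP; rewrite -ltnNge.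
(* Otherwise all [n >= 2] distances from [x i] are equal. *)
have [j0 j0A lt_q] : exists2 j, j \in A :\ i & (d j ^ n < q)%N.
  apply/exists_inP; apply: contraT => /exists_inPn noj.
  have dq j : j \in A :\ i -> (d j ^ n = q)%N.
    by move=> /noj; rewrite -leqNgt => qd; apply/eqP; rewrite eqn_leq close.
  have [j1 [j2 [j1A j2A j12]]] : exists j1 j2, [/\ j1 \in A :\ i, j2 \in A :\ i & j1 != j2].
    have /card_gt1P[j1 [j2 [? ? ?]]] : (1 < #|A :\ i|)%N by rewrite cardAi.
    by exists j1, j2.
  have d12 : d j1 = d j2.
    have n_gt0 := ltnW n_gt1.
    by apply/eqP; rewrite -(eqn_exp2r _ _ n_gt0) !dq.
  have := close j1 j2; rewrite leqNgt => /negP[].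
  rewrite -{1}(dq j1 j1A) ltn_exp2r ?(ltnW n_gt1) //.
  have := d_gt0 j1 j1A; have : x j1 != x j2 by rewrite (inj_eq x_inj).
  move: d12; rewrite /d; lia.
rewrite -(@ltn_exp2r _ _ n) ?(ltnW n_gt1) //.
rewrite (big_morph (fun m => m ^ n)%N (fun a b => expnMn a b n) (exp1n n)).
rewrite (big_setD1 j0) //= -[X in (_ < _ ^ X)%N]cardAi (cardsD1 j0) j0A expnS.
apply: (@leq_ltn_trans (d j0 ^ n * q ^ #|A :\ i :\ j0|)%N).
  rewrite leq_mul // -prod_nat_const; apply: leq_prod => j _; exact: close.
by rewrite ltn_pmul2r // expn_gt0 q_gt0.
Qed.

(** Once the largest root is set aside, two roots are closer to each other than
one of them is to the largest, which makes the inequality on distances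
strict. *)
Lemma clustered_roots_card (R : realType) (T : finType) (x : T -> int)
    (P : {poly int}) (n q : nat) :
  (1 < n)%N -> (1 < q)%N -> injective x -> (size P <= n.+1)%N ->
  gcdn (coef_gcd P) q = 1%N ->
  (forall i, (q %| `|P.[x i]%R|)%N) ->
  (forall i j, (`|x i - x j| ^ n <= q)%N) ->
  (#|T| <= 2 * (n - 1) ^ 2 * omega q)%N.
Proof.
move=> n_gt1 q_gt1 x_inj sizeP gcdPq rootP close.
have w_gt0 := omega_gt0 q_gt1.
have [w1|w_neq1] := eqVneq (omega q) 1%N.
  have := prime_power_roots_card n_gt1 q_gt1 w1 x_inj sizeP gcdPq rootP close.
  by rewrite w1 => /leq_trans; apply; nia.
have [i0 _|T0] := pickP T; last by rewrite eq_card0.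
have [M _ Mmax] := @arg_maxP _ _ _ i0 xpredT x isT.
have Mle i : x i <= x M by exact: Mmax.
pose T' := {i : T | i != M}.
have cardT' : #|T| = #|{: T'}|.+1.
  rewrite card_sig -[LHS]cardsT (cardsD1 M) inE add1n -cardsE; congr _.+1.
  by apply: eq_card => i; rewrite !inE andbT.
have n_gt0 := ltnW n_gt1.
have close' (i j : T') : (`|x (val i) - x (val j)| ^ n < q)%N.
  suff [k lt_k] : exists k, (`|x (val i) - x (val j)| < `|x k - x M|)%N.
    by apply: leq_trans (close k M); rewrite ltn_exp2r.
  have ltM (k : T') : x (val k) < x M.
    by rewrite lt_neqAle Mle andbT (inj_eq x_inj) (valP k).
  have [ij|ji] := leP (x (val i)) (x (val j)).
    by exists (val i); move: (ltM j) ij; lia.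
  by exists (val j); move: (ltM i) ji; lia.
have x'_inj : injective (x \o val : T' -> int) by apply: inj_comp x_inj val_inj.
have le_T' := close_roots_card R n_gt1 q_gt1 x'_inj sizeP gcdPq (fun i => rootP (val i)) close'.
rewrite cardT' subn1; apply: (leq_ltn_trans le_T'); have m_gt0 : (0 < n.-1)%N by lia.
have w_gt1 : (1 < omega q)%N by lia.
have := leq_mul m_gt0 w_gt1; have := leq_pmull (n.-1 * omega q) m_gt0.
rewrite -mulnn; lia.
Qed.

(** * Roots in an interval *)

Lemma itv_points_close (R : realType) (I : interval R) (n q : nat) (a b : int) :
  (0 < n)%N ->
  (lebesgue_measure [set` I] <= ((q%:R : R) `^ (n%:R)^-1)%:E)%E ->
  a%:~R \in I -> b%:~R \in I -> (`|a - b| ^ n <= q)%N.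
Proof.
move=> n_gt0 lenI.
wlog le_ab : a b / a <= b => [wl|] aI bI.
  by have [ab|/ltW ba] := leP a b; [|rewrite distnC]; apply: wl.
have sub : [set` `[a%:~R : R, b%:~R]] `<=` [set` I].
  move=> z /=; rewrite in_itv /=.
  by apply: (@interval_is_interval R I a%:~R b%:~R).
have : ((b - a)%:~R%:E <= ((q%:R : R) `^ (n%:R)^-1)%:E)%E.
  apply: le_trans lenI.
  apply: (@le_trans _ _ (lebesgue_measure [set` `[a%:~R : R, b%:~R]])); last first.
    by apply: le_measure => //; rewrite inE /=; exact: measurable_itv.
  rewrite lebesgue_measure_itv /= lte_fin ltr_int.
  have [_|] := ltP a b; first by rewrite -EFinB intrB.
  by move=> ba; rewrite lee_fin lerz0 subr_le0.
rewrite lee_fin => le_q.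
have ba_ge0 : 0 <= b - a by rewrite subr_ge0.
rewrite distnC -(ler_nat R) natrX natr_absz (ger0_norm ba_ge0).
have : ((b - a)%:~R : R) ^+ n <= ((q%:R : R) `^ (n%:R)^-1) ^+ n.
  by rewrite lerXn2r ?nnegrE ?ler0z ?powR_ge0.
by rewrite -[X in _ <= X]powR_mulrn ?powR_ge0 // -powRrM mulVf ?pnatr_eq0 -?lt0n // powRr1.
Qed.

Theorem theorem2p7 (R : realType) (P : {poly int}) (n q : nat)
    (n_ge2 : (2 <= n)%N) (degP : size P = n.+1)
    (q_ge2 : (2 <= q)%N) (gcdPq : gcdn (coef_gcd P) q = 1%N)
    (I : interval R)
    (lenI : (lebesgue_measure [set` I] <= ((q%:R : R) `^ (n%:R)^-1)%:E)%E) :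
  exists2 W : nat, (roots_mod_in P q I #= `I_W)%card
    & (W <= 2 * (n - 1) ^ 2 * omega q)%N.
Proof.
(* Bounding all finite sets of roots gives finiteness as well. *)
have bound (X : {fset int}) : [set` X] `<=` roots_mod_in P q I ->
    (#|` X| <= 2 * (n - 1) ^ 2 * omega q)%N.
  move=> XS; rewrite cardfE.
  have Xroot (i : X) := XS (val i) (valP i).
  apply: (@clustered_roots_card R X val P) => //; first by rewrite degP.
  - by move=> i; have [_ /eqP] := Xroot i; rewrite eqz_mod_dvd subr0.
  - move=> i j; have [iI _] := Xroot i; have [jI _] := Xroot j.
    exact: itv_points_close (ltnW n_ge2) lenI iI jI.
have [X XE] : exists X : {fset int}, roots_mod_in P q I = [set` X].
  apply/finite_fsetP; apply: contrapT => inf.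
  have [X XS cardX] := infinite_set_fset (2 * (n - 1) ^ 2 * omega q).+1 inf.
  by have := bound X XS; rewrite leqNgt cardX.
exists #|` X|; last by apply: bound; rewrite XE.
by rewrite XE; apply/card_eq_fsetP.
Qed.
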